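(* Let $A \subset \mathbb{F}_2[x]$ be a primitive set of monic polynomials with $A \neq \{1\}$. Then $$\mathcal{F}(A) < 1 + \frac{e^{\gamma}}{2} = 1.890536\ldots.$$
   Context: $\mathbb{F}_2$ is the field with $2$ elements. A set $A \subset \mathbb{F}_2[x]$ of monic polynomials is primitive if no element of $A$ divides another (distinct) element of $A$. Here $\mathcal{F}(A) = \sum_{a \in A} \frac{1}{2^{\deg a} \deg a}$, and $\gamma = 0.577215\ldots$ is the Euler–Mascheroni constant. *)

(* Defs.v *)
From HB Require Import structures.
From mathcomp Require Import all_boot all_order all_algebra.
From mathcomp Require Import all_classical all_reals all_analysis.
Set Implicit Arguments. Unset Strict Implicit. Unset Printing Implicit Defensive.
Import Order.TTheory GRing.Theory Num.Theory.
Import numFieldNormedType.Exports.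
Local Open Scope classical_set_scope.
Local Open Scope ring_scope.

Definition monic_set (A : set {poly 'F_2}) : Prop :=
  forall a, A a -> a \is monic.

Definition primitive_set (A : set {poly 'F_2}) : Prop :=
  forall a b, A a -> A b -> a != b -> ~~ (a %| b).

Definition deg (p : {poly 'F_2}) : nat := (size p).-1.

(* The sum has nonnegative terms, so it is taken in the extended reals, where it
   always exists; an upper bound by a real number includes summability.  The
   inverse is that of \bar R, for which 0^-1 = +oo, so that F({1}) = +oo. *)
Definition erdos_sum (R : realType) (A : set {poly 'F_2}) : \bar R :=
  (\esum_(a in A) ((2 ^ deg a * deg a)%N%:R%:E : \bar R)^-1)%E.

(* series harmonic n = 1 + 1/2 + ... + 1/n, and ln 0 = 0. *)
Definition euler_gamma (R : realType) : R :=
  limn (fun n : nat => series harmonic n - ln n%:R).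

(* Main.v *)
(** Fix an ordering of the irreducible polynomials by degree and consider the
    random walk that starts at 1 and treats the irreducibles [p] in turn:
    multiply by [p] and stay at [p] with probability [1/|p|], otherwise pass to
    the next one.  A monic [a] with largest prime factor [P] is reached with
    probability [V a = |a|^-1 * prod_(p < P) (1 - 1/|p|)], and along one walk the
    reached polynomials form a chain for divisibility, so the [V a] sum to at
    most 1 over a primitive set.  Since [d] times the number of irreducibles of
    degree [d] is at most [2^d - 2] for [d > 1], a Mertens-type lower bound on the
    product yields, when [deg a > 1], [1/(|a| deg a) <= 1.84 V a] for reducible [a]
    (whose prime factors have degree less than [deg a]) and [<= 2.04 V a] in
    general.
    The irreducibles of degree at least 2 have total [V] at most 1/4, so without
    linear polynomials the sum is at most 1.84 + 0.2/4 = 1.89.  A linear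
    polynomial of [A] may be taken first in the ordering; one or two of them then
    contribute 1/2 each and use up [V]-mass 1/2 or 3/4.

    For the numerical value, [H_n - ln n - 1/(2n) + 1/(12n^2)] decreases to gamma
    and becomes increasing after subtracting [1/(60n^4)]; both are evaluated at
    [n = 16]. *)
Require Import Defs.
From HB Require Import structures.
From mathcomp Require Import all_boot all_order all_algebra all_field.
From mathcomp Require Import finmap.
From mathcomp Require Import all_classical all_reals all_analysis.
From mathcomp Require Import zify ring lra.
Set Implicit Arguments. Unset Strict Implicit. Unset Printing Implicit Defensive.
Import Order.TTheory GRing.Theory Num.Theory.
Import numFieldNormedType.Exports.
Local Open Scope classical_set_scope.
Local Open Scope ring_scope.

(** * Kraft's inequality for antichains of polynomials *)

(* [n] is fuel: one unit is spent per division by, or removal of, the head of [l]. *)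
Fixpoint visit (F : fieldType) (R : numDomainType) (w : {poly F} -> R)
    (n : nat) (l : seq {poly F}) (a : {poly F}) : R :=
  if a == 1 then 1 else
  match n, l with
  | n'.+1, p :: l' =>
      if p %| a then w p * visit w n' l (a %/ p)
      else (1 - w p) * visit w n' l' a
  | _, _ => 0
  end.

Definition dvd_antichain (F : fieldType) (A : seq {poly F}) :=
  {in A &, forall a b, a %| b -> a = b}.

Lemma dvd_antichain1 (F : fieldType) (A : seq {poly F}) :
  uniq A -> dvd_antichain A -> 1 \in A -> A = [:: 1].
Proof.
move=> uA hA A1.
have eq1 b : b \in A -> b = 1 by move=> Ab; rewrite -(hA 1 b) ?dvd1p.
case: A uA hA A1 eq1 => // a [|b A] /= uA _ _ eq1.
  by rewrite (eq1 a) ?mem_head.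
move: uA; rewrite (eq1 a) ?mem_head// (eq1 b) ?inE ?eqxx ?orbT//.
Qed.

(** Induction on the fuel: the multiples of [p], once divided by [p], and the non-multiples are
    again antichains, so the two branches contribute at most [w p] and [1 - w p]. *)
Lemma kraft (F : fieldType) (R : numDomainType) (w : {poly F} -> R) n l
    (A : seq {poly F}) :
  (forall p, p \in l -> 0 <= w p <= 1) -> uniq A -> dvd_antichain A ->
  \sum_(a <- A) visit w n l a <= 1.
Proof.
have stop n' l' B : 1 \in B -> uniq B -> dvd_antichain B ->
    \sum_(a <- B) visit w n' l' a <= 1.
  move=> B1 uB hB; rewrite (dvd_antichain1 uB hB B1) big_seq1.
  by case: n' => [|n'] /=; rewrite eqxx.
elim: n l A => [|n IHn] [|p l] A hw uA hA;
    case: (boolP (1 \in A)) => A1; try exact: stop.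
(* With 1 outside [A], exhausted fuel or an empty list makes every visit 0. *)
1-3: rewrite big_seq big1 ?ler01// => a Aa /=; 
  by rewrite ifN//; apply: contraNneq A1 => <-.
rewrite (bigID (fun a => p %| a)) /=.
have /andP[w0 w1] := hw p (mem_head _ _).
have neq1 a : a \in A -> (a == 1) = false.
  by move=> Aa; apply: contraNF A1 => /eqP <-.
rewrite -big_filter -[X in _ + X]big_filter.
set D := [seq a <- A | p %| a]; set E := [seq a <- A | ~~ (p %| a)].
rewrite [leRHS](_ : 1 = w p * 1 + (1 - w p) * 1); last by ring.
apply: lerD.
- rewrite [leLHS](_ : _ = w p * \sum_(a <- map (fun a => a %/ p) D)
      visit w n (p :: l) a); last first.
    rewrite big_map mulr_sumr; apply: eq_big_seq => a.
    by rewrite mem_filter => /andP[-> /neq1 ->].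
  have DK : {in D, forall a, a %/ p * p = a}.
    by move=> a; rewrite mem_filter => /andP[/divpK].
  apply: ler_wpM2l => //; apply: IHn => //.
    rewrite map_inj_in_uniq ?filter_uniq// => a b Da Db eab.
    by rewrite -(DK a Da) eab DK.
  move=> _ _ /mapP[a Da ->] /mapP[b Db ->] ab; congr (_ %/ _).
  have [Aa Ab] : a \in A /\ b \in A.
    by move: Da Db; rewrite !mem_filter => /andP[_ ?] /andP[_ ?].
  by apply: hA => //; rewrite -(DK a Da) -(DK b Db) dvdp_mul.
- rewrite [leLHS](_ : _ = (1 - w p) * \sum_(a <- E) visit w n l a); last first.
    rewrite mulr_sumr; apply: eq_big_seq => a.
    by rewrite mem_filter => /andP[/negbTE -> /neq1 ->].
  apply: ler_wpM2l; first by rewrite subr_ge0.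
  apply: IHn => [q lq||a b]; rewrite ?filter_uniq//.
    by apply: hw; rewrite in_cons lq orbT.
  by rewrite !mem_filter => /andP[_ ?] /andP[_ ?]; apply: hA.
Qed.

(** * Irreducible polynomials over a finite field *)

Lemma exists_irreducible_factor (F : fieldType) (a : {poly F}) :
  a \is monic -> a != 1 ->
  exists q : {poly F}, [/\ irreducible_poly q, q \is monic & q %| a].
Proof.
have [n] := ubnP (size a); elim: n a => // n IHn a ltan amon a1.
have a0 := monic_neq0 amon.
have sa : (1 < size a)%N.
  rewrite ltn_neqAle size_poly_gt0 a0 andbT eq_sym.
  apply: contraNneq a1 => /eqP/size_poly1P[c _ ac].
  by move: amon; rewrite ac monicE lead_coefC => /eqP ->.
have [irr|nirr] := pselect (irreducible_poly a).
  by exists a; split.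
have [q [sq qa nqa]] : exists q : {poly F}, [/\ size q != 1%N, q %| a & ~~ (q %= a)].
  apply: contrapT => H; apply: nirr; split => // q sq qa.
  by apply: contrapT => /negP nqa; apply: H; exists q.
have q0 : q != 0 by apply: contraNneq a0 => q0; rewrite q0 dvd0p in qa.
have sqa : (size q < size a)%N.
  by rewrite ltn_neqAle dvdp_leq// andbT -dvdp_size_eqp in nqa *.
pose q' := (lead_coef q)^-1 *: q.
have lq0 : (lead_coef q)^-1 != 0 by rewrite invr_eq0 lead_coef_eq0.
have q'q : q' %= q by rewrite eqp_scale.
have [|||r [irr rmon rq]] := IHn q'.
- by rewrite (eqp_size q'q) (leq_trans sqa).
- by rewrite monicE lead_coefZ mulVf// lead_coef_eq0.
- by apply: contraNneq sq => q'1; rewrite -(eqp_size q'q) q'1 size_poly1.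
exists r; split => //; apply: dvdp_trans qa; by rewrite -(eqp_dvdr _ q'q).
Qed.

(** In the field $F[x]/(p)$, which has $|F|^{\deg p}$ elements, raising to that power fixes the
    class of $x$. *)
Lemma irreducible_dvd_XnsubX (F : finFieldType) (p : {poly F}) :
  irreducible_poly p -> p \is monic ->
  p %| 'X^(#|F| ^ (size p).-1) - 'X.
Proof.
move=> irr mon; have hI : monic_irreducible_poly p by [].
have := expf_card (in_qpoly p 'X : {poly %/ p with hI}).
rewrite card_qfpoly => e.
have {e} : in_qpoly p ('X^(#|F| ^ (size p).-1) - 'X) = 0.
  by rewrite rmorphB rmorphXn /= [X in X - _]e subrr.
move/(congr1 val) => /=; rewrite (mk_monicE hI) => e.
by rewrite Pdiv.Idomain.dvdpE /Pdiv.Ring.rdvdp e.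
Qed.

Lemma prod_irreducible_dvd (F : fieldType) (s : seq {poly F}) (m : {poly F}) :
  uniq s -> {in s, forall p, irreducible_poly p /\ p \is monic} ->
  {in s, forall p, p %| m} -> \prod_(p <- s) p %| m.
Proof.
elim: s => [|p s IHs] /=; first by rewrite big_nil dvd1p.
move=> /andP[ps us] hs hm; rewrite big_cons Gauss_dvdp.
  rewrite hm ?mem_head//= IHs// => q qs; [apply: hs|apply: hm];
  by rewrite in_cons qs orbT.
have [pirr pmon] := hs p (mem_head _ _).
rewrite big_seq; apply: (big_ind (coprimep p)) => [|q r pq pr|q qs].
- by rewrite coprimep1.
- by rewrite coprimepMr pq.
have [qirr qmon] : irreducible_poly q /\ q \is monic.
  by apply: hs; rewrite in_cons qs orbT.
rewrite irreducible_poly_coprime//; apply: contraNN ps => pq.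
suff /eqP -> : p == q by [].
rewrite -eqp_monic//; apply: qirr.2 pq.
by rewrite neq_ltn pirr.1 orbT.
Qed.

Lemma size_prod_deg (s : seq {poly 'F_2}) d :
  {in s, forall p, p \is monic /\ deg p = d} ->
  size (\prod_(p <- s) p) = (d * size s).+1.
Proof.
elim: s => [|p s IHs] hs; first by rewrite big_nil size_poly1 muln0.
have [pm pd] := hs p (mem_head _ _).
have hs' : {in s, forall p, p \is monic /\ deg p = d}.
  by move=> q qs; apply: hs; rewrite in_cons qs orbT.
rewrite big_cons size_Mmonic ?monic_neq0//; last first.
  by rewrite big_seq; apply: monic_prod => q /hs' [].
rewrite IHs// addnS /= mulnS -pd /deg.
by have := monic_neq0 pm; rewrite -size_poly_gt0; case: (size p).
Qed.

(** The members of [s] together with $x$ and $x-1$ are distinct irreducible divisors of $x^{2^d}-x$;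
    comparing degrees gives $d|s|+2 \le 2^d$. *)
Lemma irreducible_count (s : seq {poly 'F_2}) d : (1 < d)%N -> uniq s ->
  {in s, forall p, [/\ irreducible_poly p, p \is monic & deg p = d]} ->
  (d * size s <= 2 ^ d - 2)%N.
Proof.
move=> d1 us hs.
pose t := 'X :: ('X - 1) :: s.
have hX : irreducible_poly ('X : {poly 'F_2}).
  by rewrite -[X in irreducible_poly X]subr0 -polyC0; apply: irredp_XsubC.
have hX1 : irreducible_poly ('X - 1 : {poly 'F_2}) by apply: irredp_XsubC.
have X1mon : ('X - 1 : {poly 'F_2}) \is monic by rewrite monicXsubC.
have ut : uniq t.
  rewrite /= !inE us !negb_or andbT -!andbA.
  rewrite -subr_eq0 opprB addrCA subrr addr0 oner_eq0 /=.
  apply/andP; split; apply/negP => /hs[_ _ e]; move: d1; rewrite -e /deg.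
    by rewrite size_polyX.
  by rewrite -polyC1 size_XsubC.
have ht : {in t, forall p, irreducible_poly p /\ p \is monic}.
  move=> p; rewrite !inE => /or3P[/eqP ->|/eqP ->|/hs[? ? _]] //.
  by rewrite monicX.
have /dvdp_leq : \prod_(p <- t) p %| 'X^(2 ^ d) - 'X.
  apply: prod_irreducible_dvd => // p; rewrite !inE => /or3P[/eqP ->|/eqP ->|].
  - by rewrite dvdp_sub ?dvdpp// dvdp_exp ?expn_gt0 ?dvdpp.
  - rewrite -polyC1 dvdp_XsubCl rootE !hornerE expr1n subrr//.
  - move=> /hs[irr mon pd]; have := irreducible_dvd_XnsubX irr mon.
    by rewrite card_Fp// -/(deg p) pd.
have e2 : (2 < 2 ^ d)%N by rewrite (@ltn_exp2l 2 1).
have sXX : size ('X^(2 ^ d) - 'X : {poly 'F_2}) = (2 ^ d).+1.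
  by rewrite size_polyDl size_polyXn// size_polyN size_polyX ltnW.
rewrite -size_poly_gt0 sXX => /(_ isT).
have smon : \prod_(p <- s) p \is monic.
  by rewrite big_seq; apply: monic_prod => p /hs[].
rewrite /t !big_cons size_Mmonic ?size_Mmonic ?monic_neq0// ?monicMr//.
  rewrite size_polyX -polyC1 size_XsubC (@size_prod_deg s d).
    by rewrite !addSn add0n /= => h; rewrite leq_subRL ?(ltnW e2).
  by move=> p /hs[].
exact: monicX.
Qed.

(** * The walk over the irreducibles of F_2[x] *)

Definition density (R : numFieldType) (p : {poly 'F_2}) : R := (2 ^+ deg p)^-1.

(** For [l] listing all irreducibles of degree at most [n], this is the Mertens product: the density
    of polynomials without prime factors of degree at most [n]. *)
Definition sieve (R : numFieldType) (l : seq {poly 'F_2}) (n : nat) : R :=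
  \prod_(p <- l | (deg p <= n)%N) (1 - density R p).

Lemma density_itv (R : numFieldType) p : 0 <= density R p <= 1.
Proof.
by rewrite /density invr_ge0 exprn_ge0//= invf_le1 ?exprn_gt0// exprn_ege1// ler1n.
Qed.

Lemma sieve_itv (R : numFieldType) l n : 0 <= sieve R l n <= 1.
Proof.
rewrite /sieve; apply/andP; split.
  by apply: prodr_ge0 => p _; have := density_itv R p; rewrite subr_ge0 => /andP[].
apply: prodr_ile1 => p _; have := density_itv R p.
by rewrite subr_ge0 gerBl => /andP[-> ->].
Qed.

Lemma degM (p q : {poly 'F_2}) :
  p != 0 -> q != 0 -> deg (p * q) = (deg p + deg q)%N.
Proof.
move=> p0 q0; rewrite /deg size_mul//.
move: p0 q0; rewrite -!size_poly_gt0.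
by case: (size p) => // i _; case: (size q) => // j _; rewrite addnS.
Qed.

Lemma deg_irreducible_gt0 (p : {poly 'F_2}) : irreducible_poly p -> (0 < deg p)%N.
Proof. by move=> [sp _]; rewrite /deg -subn1 subn_gt0. Qed.

(** Let $P$ be the last prime factor of [a] in [l]. Then [2 ^+ deg a * visit] is the product of
    $1-1/|p|$ over $p$ before $P$. The sieve contains these factors and also $1-1/|P| \le 1-2^{-n}$;
    its other factors are at most 1. The fuel suffices because a division shrinks [a] and a skip
    shortens [l]. *)
Lemma visit_ge (R : realFieldType) m l (a : {poly 'F_2}) n :
  sorted (fun p q => deg p <= deg q)%N l ->
  {in l, forall p, irreducible_poly p /\ p \is monic} ->
  a \is monic -> a != 1 ->
  (forall q, irreducible_poly q -> q \is monic -> q %| a ->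
     q \in l /\ (deg q <= n)%N) ->
  (size a + size l <= m)%N ->
  sieve R l n <= (1 - (2 ^+ n)^-1) * (2 ^+ deg a * visit (density R) m l a).
Proof.
elim: m l a => [|m IHm] l a sl hl amon a1 ha szm.
  by move: szm; rewrite leqNgt addn_gt0 size_poly_gt0 monic_neq0.
have [q [qirr qmon qa]] := exists_irreducible_factor amon a1.
have [ql qn] := ha q qirr qmon qa.
case: l sl hl ha szm ql => [//|p l] sl hl ha szm ql.
have [pirr pmon] := hl p (mem_head _ _).
rewrite /= (negbTE a1).
(* The head has least degree in the sorted list, which contains the prime factor [q]; hence [p]
   counts in the sieve. *)
have pn : (deg p <= n)%N.
  apply: leq_trans qn; move: ql; rewrite inE => /predU1P[->//|ql].
  move: sl; rewrite /= path_sortedE; last by move=> ? ? ?; apply: leq_trans.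
  by move=> /andP[/allP/(_ _ ql)].
have [pa|npa] := boolP (p %| a).
- have aE := divpK pa; set b := a %/ p in aE *.
  have p0 := monic_neq0 pmon.
  have b0 : b != 0 by apply: contraNneq (monic_neq0 amon) => b0; rewrite -aE b0 mul0r.
  have bmon : b \is monic by rewrite -(monicMr _ pmon) aE.
  have da : deg a = (deg b + deg p)%N by rewrite -aE degM.
  have d2 : 2 ^+ deg a * (density R p * visit (density R) m (p :: l) b) =
      2 ^+ deg b * visit (density R) m (p :: l) b.
    by rewrite da exprD /density -!mulrA mulVKf// expf_neq0// pnatr_eq0.
  rewrite d2; have [b1|b1] := eqVneq b 1.
    rewrite b1 /deg size_poly1 expr0 mul1r.
    have -> : visit (density R) m (p :: l) 1 = 1 by case: (m) => [|?] /=; rewrite eqxx.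
    rewrite mulr1 /sieve big_cons pn.
    have /andP[s0 s1] := sieve_itv R l n; rewrite -/(sieve R l n).
    apply: (@le_trans _ _ (1 - density R p)).
      have /andP[_] := density_itv R p; rewrite -subr_ge0 => d1.
      exact: ler_piMr.
    by rewrite lerD2l lerN2 /density lef_pV2 ?posrE ?exprn_gt0// ler_eXn2l// ltr1n.
  apply: IHm => // [q' q'irr q'mon q'b|].
    by apply: ha => //; rewrite -aE dvdp_mulr.
  move: szm; rewrite -aE size_mul//.
  have /= := pirr.1; case: (size p) => [|[|i]]// _; move: (size b) (size l) => j k.
  by clear; lia.
- rewrite /sieve big_cons pn -/(sieve R l n).
  rewrite [leRHS](_ : _ = (1 - density R p) *
     ((1 - (2 ^+ n)^-1) * (2 ^+ deg a * visit (density R) m l a))); last by ring.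
  apply: ler_wpM2l; first by have := density_itv R p; lra.
  apply: IHm => // [|q' lq'|q' q'irr q'mon q'a|].
  - by move: sl => /= /path_sorted.
  - by apply: hl; rewrite inE lq' orbT.
  - have [] := ha q' q'irr q'mon q'a; rewrite inE => /predU1P[q'p|-> ->//].
    by rewrite -q'p q'a in npa.
  - by move: szm; rewrite /= addnS ltnS.
Qed.

(** * Bounds for the logarithm *)

(** $\ln(1+u)-\ln(1-u) = 2(u+u^3/3+u^5/5+\dots)$; the free coefficient [a] serves both the lower and
    the upper bound. *)
Lemma is_derive_ln_atanh (R : realType) (a : R) (x : R) : -1 < x < 1 ->
  is_derive x 1 (fun u : R => ln (1 + u) - ln (1 - u)
      - 2 * (u + u ^+ 3 / 3 + a * u ^+ 5))
    (2 / (1 - x ^+ 2) - 2 * (1 + x ^+ 2 + 5 * a * x ^+ 4)).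
Proof.
move=> /andP[x1 x2].
have p1 : 0 < 1 + x by lra.
have p2 : 0 < 1 - x by lra.
have dg1 : is_derive x 1 (fun u : R => 1 + u) 1.
  by apply: is_derive_eq; rewrite add0r mul1r.
have dg2 : is_derive x 1 (fun u : R => 1 - u) (-1).
  by apply: is_derive_eq; rewrite add0r mul1r.
have d1 : is_derive x 1 (fun u : R => ln (1 + u)) _ :=
  @is_derive1_comp R (@ln R) (fun u => 1 + u) x _ _ (is_derive1_ln p1) dg1.
have d2 : is_derive x 1 (fun u : R => ln (1 - u)) _ :=
  @is_derive1_comp R (@ln R) (fun u => 1 - u) x _ _ (is_derive1_ln p2) dg2.
pose P : {poly R} := 'X + 3^-1 *: 'X^3 + a *: 'X^5.
have PE u : P.[u] = u + u ^+ 3 / 3 + a * u ^+ 5.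
  by rewrite /P !(hornerD, hornerZ, hornerXn, hornerX) [3^-1 * _]mulrC.
rewrite (_ : (fun u : R => _) = (fun u : R => ln (1 + u)) - (fun u : R => ln (1 - u))
   - (2 \*: horner P)); last by apply/funext => u; rewrite -PE.
apply: is_derive_eq.
have -> : P^`().[x] = 1 + x ^+ 2 + 5 * a * x ^+ 4.
  rewrite /P !(derivD, derivZ, derivXn, derivX).
  rewrite !(hornerD, hornerZ, hornerMn, hornerXn, hornerX, hornerC).
  by rewrite /=; field.
have q : 1 - x ^+ 2 = (1 + x) * (1 - x) by ring.
rewrite q /GRing.scale /=; field.
by rewrite !lt0r_neq0.
Qed.

(** The difference vanishes at 0 and has derivative $2x^6/(1-x^2) \ge 0$. *)
Lemma ln_atanh_ge (R : realType) (u : R) : 0 <= u < 1 ->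
  2 * (u + u ^+ 3 / 3 + 5^-1 * u ^+ 5) <= ln ((1 + u) / (1 - u)).
Proof.
move=> /andP[u0 u1]; rewrite ln_div ?posrE; [|lra|lra].
rewrite -subr_ge0.
pose f (v : R) := ln (1 + v) - ln (1 - v) - 2 * (v + v ^+ 3 / 3 + 5^-1 * v ^+ 5).
have df x : x \in `[0, u] -> is_derive x 1 f
    (2 / (1 - x ^+ 2) - 2 * (1 + x ^+ 2 + 5 * 5^-1 * x ^+ 4)).
  by rewrite in_itv /= => /andP[x0 xu]; apply: is_derive_ln_atanh; lra.
have -> : 0 = f 0.
  by rewrite /f !expr0n /= addr0 subr0 subrr !mulr0 mul0r !addr0 mulr0 subr0.
have sub : {subset `]0, u[ <= `[0, u]} by exact: subset_itv_oo_cc.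
apply: (@ger0_derive1_ndecr R f 0 u) => // [x /sub /df h|x xu|].
- exact: ex_derive.
- have h := df _ (sub _ xu); rewrite derive1E derive_val.
  move: xu; rewrite in_itv /= => /andP[x0 xu].
  rewrite subr_ge0 divff ?mul1r ?pnatr_eq0//.
  have d0 : 0 < 1 - x ^+ 2 by nra.
  rewrite ler_pdivlMr// -[leLHS]mulrA ger_pMr//.
  rewrite (_ : _ * _ = 1 - x ^+ 6); last by ring.
  by rewrite gerBl exprn_ge0// ltW.
- apply: derivable_within_continuous => x /df h; exact: ex_derive.
Qed.

(* 961/4800 = 1/(5 (1 - 31^-2)) absorbs the tail of the artanh series. *)
Lemma ln_atanh_le (R : realType) (u : R) : 0 <= u <= 31^-1 ->
  ln ((1 + u) / (1 - u)) <= 2 * (u + u ^+ 3 / 3 + 961 / 4800 * u ^+ 5).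
Proof.
move=> /andP[u0 u1]; rewrite ln_div ?posrE; [|lra|lra].
rewrite -subr_le0.
pose f (v : R) := ln (1 + v) - ln (1 - v) - 2 * (v + v ^+ 3 / 3 + 961 / 4800 * v ^+ 5).
have df x : x \in `[0, u] -> is_derive x 1 f
    (2 / (1 - x ^+ 2) - 2 * (1 + x ^+ 2 + 5 * (961 / 4800) * x ^+ 4)).
  by rewrite in_itv /= => /andP[x0 xu]; apply: is_derive_ln_atanh; lra.
have -> : 0 = f 0.
  by rewrite /f !expr0n /= addr0 subr0 subrr !mulr0 mul0r !addr0 mulr0 subr0.
have sub : {subset `]0, u[ <= `[0, u]} by exact: subset_itv_oo_cc.
apply: (@ler0_derive1_le_cc R f 0 u) => // [x /sub /df h|x xu|||];
  try by rewrite in_itv /= ?lexx ?u0.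
- exact: ex_derive.
- have h := df _ (sub _ xu); rewrite derive1E derive_val.
  move: xu; rewrite in_itv /= => /andP[x0 xu].
  rewrite subr_le0.
  have xx : x ^+ 2 <= 961^-1 by rewrite expr2; nra.
  have d0 : 0 < 1 - x ^+ 2 by lra.
  rewrite ler_pdivrMr// -[leRHS]mulrA ler_pMr//.
  (* The bracket vanishes at $x = 1/31$, which fixes the range of [u]. *)
  rewrite -subr_ge0 (_ : _ - _ = x ^+ 4 * (960^-1 - 961 / 960 * x ^+ 2)); last by field.
  by apply: mulr_ge0; [rewrite exprn_ge0// ltW|lra].
- apply: derivable_within_continuous => x /df h; exact: ex_derive.
Qed.

(** * The sieve product *)

(** With $u = 1/(2d)$, the first term of the series gives $\ln((1+u)/(1-u)) \ge 2u = 1/d$. The bound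
    has this rational form because it telescopes in $d$. *)
Lemma expR_inv_le (R : realType) (d : nat) : (0 < d)%N ->
  (2 * d%:R - 1) / (2 * d%:R + 1) <= expR (- (d%:R)^-1) :> R.
Proof.
move=> d0; have d1 : 1 <= d%:R :> R by rewrite ler1n.
have dp : 0 < d%:R :> R by lra.
have dn : d%:R != 0 :> R by rewrite gt_eqF.
pose u : R := (2 * d%:R)^-1.
have u0 : 0 < u by rewrite invr_gt0; lra.
have u1 : u < 1 by rewrite invf_lt1; lra.
have p : 0 < (1 + u) / (1 - u) by apply: divr_gt0; lra.
have uE : (1 + u) / (1 - u) = (2 * d%:R + 1) / (2 * d%:R - 1).
  by rewrite /u; field; rewrite dn andbT gt_eqF//; lra.
rewrite expRN -[leLHS]invrK lef_pV2 ?posrE ?invr_gt0 ?expR_gt0//; last first.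
  by apply: divr_gt0; lra.
rewrite invf_div -uE -[leRHS]lnK ?posrE// ler_expR.
have := @ln_atanh_ge R u; rewrite (ltW u0) u1 => /(_ isT); apply: le_trans.
have -> : d%:R^-1 = 2 * u by rewrite /u invfM mulVKf ?pnatr_eq0.
by rewrite ler_pM2l// -addrA lerDl addr_ge0// ?divr_ge0 ?mulr_ge0 ?exprn_ge0// ltW.
Qed.

(** $1+y \le e^y$ at $y = 1/(2^d-1)$ gives $1-2^{-d} \ge e^{-y}$, and $cy \le 1/d$. *)
Lemma euler_factor_ge (R : realType) (d c : nat) : (0 < d)%N ->
  (d * c <= 2 ^ d - 1)%N ->
  (2 * d%:R - 1) / (2 * d%:R + 1) <= (1 - (2 ^+ d)^-1) ^+ c :> R.
Proof.
move=> d0 dc; apply: le_trans (expR_inv_le R d0) _.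
have t1 : (1 < 2 ^ d)%N by rewrite -[1%N](expn0 2) ltn_exp2l.
set t : R := 2 ^+ d.
have tE : t = (2 ^ d)%N%:R by rewrite natrX.
have t1' : 1 < t by rewrite tE ltr1n.
have t10 : 0 < t - 1 by lra.
have y : expR (- (t - 1)^-1) <= 1 - t^-1.
  rewrite expRN -[leRHS]invrK lef_pV2 ?posrE ?expR_gt0 ?invr_gt0//; last first.
    by rewrite subr_gt0 invf_lt1//; lra.
  apply: le_trans (expR_ge1Dx _).
  rewrite le_eqVlt; apply/orP; left; apply/eqP; field.
  by rewrite !gt_eqF //; lra.
apply: (@le_trans _ _ (expR (- (t - 1)^-1) ^+ c)); last first.
  by rewrite lerXn2r// ?nnegrE ?expR_ge0// (le_trans (expR_ge0 _) y).
rewrite -expRM_natl ler_expR mulrN lerN2.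
rewrite ler_pdivrMr// mulrC ler_pdivlMr ?ltr0n//.
rewrite (_ : t - 1 = (2 ^ d - 1)%N%:R); last by rewrite natrB ?(ltnW t1) -?tE.
by rewrite -natrM ler_nat mulnC.
Qed.

Lemma sieveS (R : numFieldType) l n :
  sieve R l n.+1 =
  sieve R l n * (1 - (2 ^+ n.+1)^-1) ^+ count (fun p => deg p == n.+1) l.
Proof.
rewrite /sieve; elim: l => [|p l IHl]; first by rewrite !big_nil expr0 mulr1.
rewrite !big_cons /= IHl leq_eqVlt ltnS.
have [pn|pn] := eqVneq (deg p) n.+1.
  by rewrite pn ltnn /= exprD expr1 [X in 1 - X]/density pn mulrCA.
by rewrite /= add0n; case: ifP => _; rewrite ?mulrA.
Qed.

Section SieveBounds.
Variables (R : realType) (l : seq {poly 'F_2}).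
Hypothesis ul : uniq l.
Hypothesis hl : {in l, forall p, irreducible_poly p /\ p \is monic}.
Hypothesis hl1 : sieve R l 1 = 4^-1.

Lemma count_deg d : (1 < d)%N ->
  (d * count (fun p => deg p == d) l <= 2 ^ d - 2)%N.
Proof.
move=> d1; rewrite -size_filter; apply: irreducible_count => //.
  exact: filter_uniq.
by move=> p; rewrite mem_filter => /andP[/eqP pd /hl[]].
Qed.

(** The condition on [k] says that it is at least the floor of $(2^{n+1}-2)/(n+1)$, hence at least
    the number of irreducibles of degree $n+1$ in [l]. *)
Lemma sieve_step n k : (0 < n)%N -> (2 ^ n.+1 - 2 < n.+1 * k.+1)%N ->
  sieve R l n * (1 - (2 ^+ n.+1)^-1) ^+ k <= sieve R l n.+1.
Proof.
move=> n0 hk; rewrite sieveS; apply: ler_wpM2l.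
  by have /andP[] := sieve_itv R l n.
have x1 : 1 <= 2 ^+ n.+1 :> R by rewrite exprn_ege1// ler1n.
have x0 : 0 < 2 ^+ n.+1 :> R by lra.
apply: ler_wiXn2l; first by rewrite subr_ge0 invf_le1.
  by rewrite gerBl invr_ge0 ltW.
have := count_deg (n0 : (1 < n.+1)%N); move: (count _ _) => c hc.
by rewrite -ltnS -(ltn_pmul2l (ltn0Sn n)) (leq_ltn_trans hc).
Qed.

(** Starting from 1/4, the degrees 2 to 7 have at most 1, 2, 3, 6, 10 and 18 irreducibles; decimal
    values are rounded down. *)
Lemma sieve_small :
  [/\ 3 / 16 <= sieve R l 2, 147 / 2 ^+ 10 <= sieve R l 3,
      118 / 10 ^+ 3 + 28 / 10 ^+ 5 <= sieve R l 4,
      97 / 10 ^+ 3 + 76 / 10 ^+ 5 <= sieve R l 5 &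
      83 / 10 ^+ 3 + 51 / 10 ^+ 5 <= sieve R l 6 /\ 725 / 10 ^+ 4 <= sieve R l 7].
Proof.
have s2 : 3 / 16 <= sieve R l 2.
  by have := @sieve_step 1 1 isT isT; rewrite hl1; lra.
have s3 : 147 / 2 ^+ 10 <= sieve R l 3.
  have := @sieve_step 2 2 isT isT; move: s2.
  by rewrite (_ : 1 - _ = 7 / 8); [lra|field].
have s4 : 118 / 10 ^+ 3 + 28 / 10 ^+ 5 <= sieve R l 4.
  have := @sieve_step 3 3 isT isT; move: s3.
  by rewrite (_ : 1 - _ = 15 / 16); [lra|field].
have s5 : 97 / 10 ^+ 3 + 76 / 10 ^+ 5 <= sieve R l 5.
  have := @sieve_step 4 6 isT isT; move: s4.
  by rewrite (_ : 1 - _ = 31 / 32); [lra|field].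
have s6 : 83 / 10 ^+ 3 + 51 / 10 ^+ 5 <= sieve R l 6.
  have := @sieve_step 5 10 isT isT; move: s5.
  by rewrite (_ : 1 - _ = 63 / 64); [lra|field].
split=> //; split=> //.
have := @sieve_step 6 18 isT isT; move: s6.
by rewrite (_ : 1 - _ = 127 / 128); [lra|field].
Qed.

(* [(2n+1) * sieve n] is nondecreasing: the degree-d factor is at least exp(-1/d),
   which is at least (2d-1)/(2d+1). *)
Lemma sieve_large n : (7 <= n)%N -> 87 / 80 <= (2 * n%:R + 1) * sieve R l n.
Proof.
have [_ _ _ _ [_ s7]] := sieve_small.
(* At $n = 7$ the bound is $15 \cdot 0.0725 = 87/80$. *)
elim: n => // n IHn; rewrite leq_eqVlt => /predU1P[<-|]; first by lra.
rewrite ltnS => n7; apply: le_trans (IHn n7) _.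
have n1 : (1 < n.+1)%N by rewrite ltnS (leq_trans _ n7).
have := @euler_factor_ge R n.+1 (count (fun p => deg p == n.+1) l) isT.
have hc := count_deg n1; rewrite (leq_trans hc) ?leq_sub2l// => /(_ isT).
rewrite sieveS; set e := _ ^+ count _ _ => he.
have np : 0 < n.+1%:R :> R by rewrite ltr0n.
move: he; rewrite ler_pdivrMr; last lra.
rewrite -(natr1 n) => he; have /andP[s0 _] := sieve_itv R l n.
apply: le_trans (_ : (2 * (n%:R + 1) - 1) * sieve R l n <= _).
  by apply: ler_wpM2r => //; lra.
rewrite [leRHS](_ : _ = e * (2 * (n%:R + 1) + 1) * sieve R l n); last by ring.
exact: ler_wpM2r.
Qed.

(** For use with $n+1$ the degree of a reducible polynomial. For $n \ge 7$, $1.84(n+1) \ge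
    0.92(2n+1)$ and $0.92 \cdot 87/80 = 1.0005$, which explains the constant. *)
Lemma sieve_composite n : (0 < n)%N ->
  1 - (2 ^+ n)^-1 <= 184 / 100 * n.+1%:R * sieve R l n.
Proof.
move=> n0; have [n7|] := leqP 7 n.
  have := sieve_large n7; have /andP[s0 _] := sieve_itv R l n.
  have x0 : 0 <= (2 ^+ n)^-1 :> R by rewrite invr_ge0 exprn_ge0.
  rewrite -(natr1 n); lra.
have [s2 s3 s4 s5 [s6 _]] := sieve_small.
by case: n n0 => [//|[|[|[|[|[|[|//]]]]]]] _ _; rewrite ?hl1; lra.
Qed.

(** The tightest case is $n = 3$: $0.875$ against $2.04 \cdot 3 \cdot 147/1024 \approx 0.8785$. *)
Lemma sieve_prime n : (1 < n)%N ->
  1 - (2 ^+ n)^-1 <= 204 / 100 * n%:R * sieve R l n.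
Proof.
move=> n1; have [n7|] := leqP 7 n.
  have := sieve_large n7; have /andP[s0 _] := sieve_itv R l n.
  have x0 : 0 <= (2 ^+ n)^-1 :> R by rewrite invr_ge0 exprn_ge0.
  have n7' : 7 <= n%:R :> R by rewrite ler_nat.
  (* This encodes $n \ge \frac{7}{15}(2n+1)$, which links the goal to [sieve_large]. *)
  have : 7 * sieve R l n <= n%:R * sieve R l n by exact: ler_wpM2r.
  lra.
have [s2 s3 s4 s5 [s6 _]] := sieve_small.
by case: n n1 => [//|[//|[|[|[|[|[|//]]]]]]] _ _; lra.
Qed.

End SieveBounds.

(** * Primitive sets *)

Lemma F2_cases (x : 'F_2) : x = 0 \/ x = 1.
Proof. by case: x => [[|[|//]] h]; [left|right]; apply/val_inj. Qed.

Lemma monic_deg1 (c : 'F_2) (p : {poly 'F_2}) : p \is monic -> deg p = 1%N ->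
  p = 'X - c%:P \/ p = 'X - (c + 1)%:P.
Proof.
move=> pm pd.
have sp : size p = 2 by move: pd; rewrite /deg; case: (size p) => [|[|[|]]].
have -> : p = 'X - (- p`_0)%:P.
  apply/polyP => i; rewrite polyCN opprK coefD coefX coefC.
  case: i => [|[|i]] /=; first by rewrite add0r.
    by move: pm; rewrite monicE lead_coefE sp /= => /eqP ->; rewrite addr0.
  by rewrite nth_default ?sp// addr0.
by case: (F2_cases c) (F2_cases (- p`_0)) => -> [] ->; [left|right|right|left];
  congr ('X - _%:P); apply/val_inj.
Qed.

Lemma deg_dvd (q a : {poly 'F_2}) : a != 0 -> q %| a -> (deg q <= deg a)%N.
Proof. by move=> a0 /(dvdp_leq a0) h; rewrite /deg -!subn1 leq_sub2r. Qed.

Lemma deg_XsubC (c : 'F_2) : deg ('X - c%:P) = 1%N.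
Proof. by rewrite /deg size_XsubC. Qed.

Lemma monic_deg0 (p : {poly 'F_2}) : p \is monic -> deg p = 0%N -> p = 1.
Proof.
move=> pm pd; have sp : (size p <= 1)%N.
  by move: pd; rewrite /deg; case: (size p) => [|[|]].
move: pm; rewrite (size1_polyC sp) monicE lead_coefC => /eqP ->; exact: polyC1.
Qed.

Lemma dvdp_monic_irreducible (p q : {poly 'F_2}) :
  irreducible_poly p -> p \is monic -> irreducible_poly q -> q \is monic ->
  q %| p -> q = p.
Proof.
move=> pirr pm qirr qm qp; apply/eqP; rewrite -eqp_monic//.
by apply: pirr.2 qp; rewrite neq_ltn qirr.1 orbT.
Qed.

(** The parameter [c] decides which of the two linear polynomials heads the list. The rest comes
    from filtering the finite type of polynomials of size at most [N.+1] and sorting by degree. *)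
Lemma prime_list (N : nat) (c : 'F_2) : exists r : seq {poly 'F_2},
  let l := [:: 'X - c%:P, 'X - (c + 1)%:P & r] in
  [/\ uniq l, {in l, forall p, irreducible_poly p /\ p \is monic},
      sorted (fun p q => deg p <= deg q)%N l,
      {in r, forall p, (1 < deg p)%N} &
      forall p, irreducible_poly p -> p \is monic -> (deg p <= N)%N -> p \in l].
Proof.
pose P (p : {poly 'F_2}) := [&& irreducibleb p, p \is monic & (1 < deg p)%N].
pose r := sort (fun p q => deg p <= deg q)%N
  [seq p <- [seq polyn v | v : {poly_N.+1 'F_2}] | P p].
have rP p : p \in r -> [/\ irreducible_poly p, p \is monic & (1 < deg p)%N].
  by rewrite mem_sort mem_filter => /andP[/and3P[/irreducibleP]].
exists r => l; split.
- have c01 : 'X - c%:P != 'X - (c + 1)%:P.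
    apply/eqP => /addrI/oppr_inj/polyC_inj/eqP.
    by rewrite -subr_eq0 opprD addrA subrr add0r oppr_eq0 oner_eq0.
  rewrite /= !inE negb_or c01 /= sort_uniq filter_uniq ?andbT; last first.
    by rewrite map_inj_uniq ?enum_uniq//; exact: val_inj.
  by apply/andP; split; apply/negP => /rP[_ _]; rewrite deg_XsubC.
- move=> p; rewrite !inE => /or3P[/eqP ->|/eqP ->|/rP[]//];
  by rewrite monicXsubC; split => //; apply: irredp_XsubC.
- rewrite /= !deg_XsubC leqnn /= path_sortedE; last by move=> ? ? ?; apply: leq_trans.
  rewrite sort_sorted ?andbT; last by move=> p q; apply: leq_total.
  by apply/allP => p /rP[_ _ /ltnW]; rewrite deg_XsubC.
- by move=> p /rP[].
- move=> p pirr pm pN; have := deg_irreducible_gt0 pirr.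
  rewrite leq_eqVlt !inE => /predU1P[/esym pd|pd].
    by case: (monic_deg1 c pm pd) => ->; rewrite eqxx ?orbT.
  rewrite mem_sort mem_filter /P pm pd.
  move/irreducibleP: (pirr) => ->; apply/or3P/Or33.
  have sp : (size p <= N.+1)%N by move: pN; rewrite /deg; case: (size p).
  by apply/mapP; exists (NPoly sp); rewrite ?mem_enum.
Qed.

Lemma antichain_irreducible (A : seq {poly 'F_2}) :
  {in A, forall p, irreducible_poly p /\ p \is monic} -> dvd_antichain A.
Proof.
move=> hA a b /hA[airr am] /hA[birr bm]; exact: dvdp_monic_irreducible.
Qed.

Lemma visit1 (F : fieldType) (R : numDomainType) (w : {poly F} -> R) n l :
  visit w n l 1 = 1.
Proof. by case: n => [|n] /=; rewrite eqxx. Qed.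

Section PrimitiveSum.
Variables (R : realType) (c : 'F_2) (r : seq {poly 'F_2}) (N m : nat).
Let s : {poly 'F_2} := 'X - c%:P.
Let s' : {poly 'F_2} := 'X - (c + 1)%:P.
Let l := [:: s, s' & r].
Hypothesis ul : uniq l.
Hypothesis hl : {in l, forall p, irreducible_poly p /\ p \is monic}.
Hypothesis sl : sorted (fun p q => deg p <= deg q)%N l.
Hypothesis hr : {in r, forall p, (1 < deg p)%N}.
Hypothesis complete :
  forall p, irreducible_poly p -> p \is monic -> (deg p <= N)%N -> p \in l.
Hypothesis Nm : (N.+1 + size l <= m)%N.

Let V := visit (density R) m l.

Let term (a : {poly 'F_2}) : R := (2 ^+ deg a * (deg a)%:R)^-1.

Lemma sieve_linear : sieve R l 1 = 4^-1.
Proof.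
rewrite /sieve /l !big_cons !deg_XsubC /= big_seq_cond big_pred0.
  by rewrite /density !deg_XsubC; field.
by move=> p; apply/negP => /andP[/hr h]; rewrite leqNgt h.
Qed.

(** The walk multiplies by [s] with probability 1/2; otherwise it passes to [s'] and multiplies by
    it with probability 1/2. *)
Lemma visit_linear : V s = 2^-1 /\ V s' = 4^-1.
Proof.
rewrite /V; case: m Nm => [|[|k]] //; rewrite /= ?addnS// => _.
have ss' : (s %| s') = false.
  apply/negP => /(dvdp_monic_irreducible); rewrite !monicXsubC.
  move=> /(_ (irredp_XsubC _) isT (irredp_XsubC _) isT) e.
  by move: ul; rewrite /= e inE eqxx.
have neq1 e : ('X - e%:P == 1 :> {poly 'F_2}) = false.
  by apply/negP => /eqP/(congr1 deg); rewrite deg_XsubC /deg size_poly1.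
rewrite !neq1 !dvdpp ss' !divpp ?polyXsubC_eq0// ?eqxx /density !deg_XsubC.
by rewrite !visit1 !expr1; split; field.
Qed.

Lemma sum_visit (A : seq {poly 'F_2}) : uniq A -> dvd_antichain A ->
  \sum_(a <- A) V a <= 1.
Proof. by move=> uA hA; apply: kraft => // p _; exact: density_itv. Qed.

(** [visit_ge] bounds the sieve by $(1-2^{-n})|a|V(a)$; inserted into the sieve hypothesis, the
    positive factor $1-2^{-n}$ cancels. *)
Lemma term_le (a : {poly 'F_2}) n (C : R) : (0 < n)%N -> (0 < deg a <= N)%N ->
  a \is monic ->
  (forall q, irreducible_poly q -> q \is monic -> q %| a -> (deg q <= n)%N) ->
  1 - (2 ^+ n)^-1 <= C * (deg a)%:R * sieve R l n -> 0 <= C ->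
  term a <= C * V a.
Proof.
move=> n0 /andP[a0 aN] am hq hC C0.
have a1 : a != 1 by apply: contraTneq a0 => ->; rewrite /deg size_poly1.
have := @visit_ge R m l a n sl hl am a1.
have h q : irreducible_poly q -> q \is monic -> q %| a -> q \in l /\ (deg q <= n)%N.
  move=> qirr qm qa; split; last exact: hq.
  by apply: complete => //; apply: leq_trans aN; apply: deg_dvd; rewrite ?monic_neq0.
have sz : (size a + size l <= m)%N.
  apply: leq_trans Nm; rewrite leq_add2r; move: aN; rewrite /deg; case: (size a) => //.
move=> /(_ h sz) {h}; rewrite -/(V a) => hV.
have x1 : 0 < 1 - (2 ^+ n)^-1 :> R.
  by rewrite subr_gt0 invf_lt1 ?exprn_gt0// exprn_egt1 ?ltr1n -?lt0n.
have d0 : 0 < (deg a)%:R :> R by rewrite ltr0n.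
have t0 : 0 < 2 ^+ deg a :> R by rewrite exprn_gt0.
rewrite /term -[_^-1]mul1r ler_pdivrMr ?mulr_gt0//.
rewrite -(ler_pM2l x1) mulr1; apply: le_trans hC _.
have -> : (1 - (2 ^+ n)^-1) * (C * V a * (2 ^+ deg a * (deg a)%:R)) =
  C * (deg a)%:R * ((1 - (2 ^+ n)^-1) * (2 ^+ deg a * V a)) by ring.
by apply: ler_wpM2l => //; rewrite mulr_ge0// ltW.
Qed.

Lemma term_prime_le (a : {poly 'F_2}) : (1 < deg a <= N)%N -> a \is monic ->
  term a <= 204 / 100 * V a.
Proof.
move=> /andP[a1 aN] am; apply: (@term_le a (deg a)) => //.
- exact: ltnW.
- by rewrite (ltnW a1).
- by move=> q _ _; apply: deg_dvd; rewrite monic_neq0.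
- exact: (sieve_prime ul hl sieve_linear).
Qed.

Lemma term_composite_le (a : {poly 'F_2}) : (1 < deg a <= N)%N -> a \is monic ->
  ~ irreducible_poly a -> term a <= 184 / 100 * V a.
Proof.
move=> /andP[a1 aN] am nirr; have dE : (deg a).-1.+1 = deg a by rewrite prednK// ltnW.
apply: (@term_le a (deg a).-1) => //.
- by rewrite -ltnS dE.
- by rewrite (ltnW a1).
- move=> q qirr qm qa; rewrite -ltnS dE ltn_neqAle deg_dvd ?monic_neq0// andbT.
  (* A prime factor of full degree would be [a] itself. *)
  apply/eqP => qad; apply: nirr; suff <- : q = a by [].
  apply/eqP; rewrite -eqp_monic// -dvdp_size_eqp//.
  move: qad; rewrite /deg => /(congr1 S); rewrite !prednK ?size_poly_gt0 ?monic_neq0//.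
  by move=> ->.
- have := sieve_composite ul hl sieve_linear (n := (deg a).-1); rewrite dE; apply.
  by rewrite -ltnS dE.
Qed.

(** The last hypothesis puts a lone linear element at the head: at [s'] it would use up mass 1/4
    only, and $1/2 + 2.04 \cdot 3/4$ is too large. *)
Lemma primitive_sum_le (A : seq {poly 'F_2}) : uniq A -> dvd_antichain A ->
  {in A, forall a, a \is monic /\ (0 < deg a <= N)%N} ->
  (s' \in A -> s \in A) ->
  \sum_(a <- A) term a <= 189 / 100.
Proof.
move=> uA acA hA ss'.
have [Vs Vs'] := visit_linear.
have ns : s != s' by move: ul; rewrite /= inE negb_or => /andP[/andP[]].
have deg2 a : a \in A -> a != s -> a != s' -> (1 < deg a <= N)%N.
  move=> aA as1 as2; have [am /andP[a0 ->]] := hA a aA.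
  rewrite andbT ltn_neqAle a0 andbT.
  apply/eqP => /esym/(monic_deg1 c am)[] e; first by rewrite e eqxx in as1.
  by rewrite e eqxx in as2.
have termlin e : term ('X - e%:P) = 2^-1 by rewrite /term deg_XsubC expr1 mulr1.
have hsum := sum_visit uA acA.
have [sA|sA] := boolP (s \in A); last first.
  have s'A : s' \notin A by apply: contra ss' sA.
  (* [s], [s'] and the irreducibles of [A] form an antichain of their own. *)
  pose I := [seq a <- A | irreducibleb a].
  have hI : \sum_(a <- I) V a <= 4^-1.
    have hT : {in [:: s, s' & I], forall p, irreducible_poly p /\ p \is monic}.
      move=> p; rewrite !inE => /or3P[/eqP ->|/eqP ->|].
      - by rewrite monicXsubC; split => //; apply: irredp_XsubC.
      - by rewrite monicXsubC; split => //; apply: irredp_XsubC.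
      - by rewrite mem_filter => /andP[/irreducibleP ? /hA[]].
    have uT : uniq [:: s, s' & I].
      rewrite /= inE negb_or ns !mem_filter (negbTE sA) (negbTE s'A) !andbF.
      by rewrite filter_uniq.
    have := sum_visit uT (antichain_irreducible hT).
    by rewrite !big_cons Vs Vs'; lra.
  (* Every element is charged 1.84 and an irreducible one 0.20 more, so the total is at most $1.84 +
     0.20/4 = 1.89$. *)
  apply: (@le_trans _ _ (\sum_(a <- A) (184 / 100 * V a) +
      \sum_(a <- A | irreducibleb a) (20 / 100 * V a))).
    rewrite [X in _ + X]big_mkcond -big_split /= big_seq [leRHS]big_seq.
    apply: ler_sum => a aA.
    have am := (hA a aA).1.
    have a2 : (1 < deg a <= N)%N.
      by apply: deg2 => //; [apply: contraNneq sA|apply: contraNneq s'A] => <-.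
    case: ifPn => [_|/irreducibleP nirr].
      by apply: le_trans (term_prime_le a2 am) _; lra.
    by rewrite addr0 term_composite_le.
  rewrite -!mulr_sumr -[X in _ + _ * X]big_filter -/I; lra.
have prime_part B : {in B, forall a, [/\ a \in A, a != s & a != s']} ->
    \sum_(a <- B) term a <= 204 / 100 * \sum_(a <- B) V a.
  move=> hB; rewrite mulr_sumr big_seq [leRHS]big_seq.
  apply: ler_sum => a /hB[aA as1 as2].
  by apply: term_prime_le; [apply: deg2|case: (hA a aA)].
move: hsum; rewrite !(big_rem s sA) /= Vs termlin; set A1 := rem s A.
have hA1 a : (a \in A1) = (a != s) && (a \in A) by rewrite /A1 mem_rem_uniq// !inE.
have uA1 : uniq A1 by rewrite rem_uniq.
(* With [s] alone the bound is $1/2 + 2.04/2 = 1.52$; with both linear polynomials it is $1 + 2.04/4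
   = 1.51$. *)
have [s'A|s'A] := boolP (s' \in A1); last first.
  have := prime_part A1; move=> H hsum.
  have {}H := H _; have : \sum_(a <- A1) term a <= 204 / 100 * \sum_(a <- A1) V a.
    apply: H => a aA1; move: (aA1); rewrite hA1 => /andP[-> ->]; split => //.
    by apply: contraNneq s'A => <-.
  lra.
rewrite !(big_rem s' s'A) /= Vs' termlin; set A2 := rem s' A1 => hsum.
have : \sum_(a <- A2) term a <= 204 / 100 * \sum_(a <- A2) V a.
  apply: prime_part => a; rewrite mem_rem_uniq// !inE hA1 => /and3P[-> -> ->].
  by split.
lra.
Qed.

End PrimitiveSum.

(** * From finite antichains to arbitrary primitive sets *)

Lemma antichain_sum_le (R : realType) (A : seq {poly 'F_2}) :
  uniq A -> dvd_antichain A -> {in A, forall a, a \is monic /\ a != 1} ->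
  \sum_(a <- A) (2 ^+ deg a * (deg a)%:R)^-1 <= 189 / 100 :> R.
Proof.
move=> uA acA hA; pose N := \max_(a <- A) deg a.
have hA' : {in A, forall a, a \is monic /\ (0 < deg a <= N)%N}.
  move=> a aA; have [am a1] := hA a aA; split => //.
  rewrite lt0n (leq_bigmax_seq a)// andbT.
  by apply: contra a1 => /eqP/(monic_deg0 am) ->.
(* If $x \in A$, it is put first. Otherwise [c = 1] puts $x$ second, and the implication is
   vacuous. *)
have [c hc] : exists c : 'F_2, 'X - (c + 1)%:P \in A -> 'X - c%:P \in A.
  have [h|h] := boolP ('X - 0%:P \in A); first by exists 0.
  by exists 1; rewrite (_ : 1 + 1 = 0) ?(negbTE h)//; apply/val_inj.
have [r [ul hl sl hr cmp]] := prime_list N c.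
exact: (@primitive_sum_le R c r N _ ul hl sl hr cmp (leqnn _)).
Qed.

(** The extended sum is a supremum over finite subsets, and each of these is an antichain avoiding
    1. *)
Lemma erdos_sum_le (R : realType) (A : set {poly 'F_2}) :
  monic_set A -> primitive_set A -> A <> [set 1] ->
  (erdos_sum R A <= (189 / 100)%:E)%E.
Proof.
move=> mA pA A1.
have nA1 : ~ A 1.
  move=> a1; apply: A1; apply/seteqP; split => [a Aa|_ ->//] /=.
  apply/eqP; apply: contraT => na1; have := pA 1 a a1 Aa.
  by rewrite eq_sym na1 dvd1p => /(_ isT).
apply: ge_ereal_sup => _ [X [finX XA] <-].
have XP a : a \in fset_set X -> A a.
  by rewrite in_fset_set// inE => /XA.
rewrite fsbig_finite//= [leLHS](_ : _ =
  (\sum_(a <- fset_set X) (2 ^+ deg a * (deg a)%:R)^-1 : R)%:E).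
  rewrite lee_fin; apply: antichain_sum_le => [|a b aX bX ab|a aX].
  - exact: fset_uniq.
  - apply/eqP; apply: contraT => nab.
    by have := pA a b (XP _ aX) (XP _ bX) nab; rewrite ab.
  - split; first exact: mA (XP _ aX).
    by apply/eqP => a1; apply: nA1; rewrite -a1; exact: XP.
rewrite -sumEFin big_seq [RHS]big_seq; apply: eq_bigr => a aX.
(* A nonzero degree makes the extended inverse agree with the real one. *)
have d0 : deg a != 0%N.
  apply/eqP => /(monic_deg0 (mA _ (XP _ aX))) a1.
  by apply: nA1; rewrite -a1; exact: XP.
by rewrite inver natrM natrX mulf_eq0 expf_eq0 !pnatr_eq0 (negbTE d0) andbF.
Qed.

(** * The Euler-Mascheroni constant *)

(** By Euler-Maclaurin, $H_n - \ln n = \gamma + \frac{1}{2n} - \frac{1}{12n^2} + \frac{1}{120n^4} -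
    \dots$. So this overshoots $\gamma$ by about $1/(120n^4)$, and [gamma_lower] subtracts twice
    that. *)
Definition gamma_upper (R : realType) (n : nat) : R :=
  series harmonic n - ln n%:R - 1 / (2 * n%:R) + 1 / (12 * n%:R ^+ 2).

Definition gamma_lower (R : realType) (n : nat) : R :=
  gamma_upper R n - 1 / (60 * n%:R ^+ 4).

Lemma harmonicS (R : realType) n :
  series harmonic n.+1 = series harmonic n + (n%:R + 1)^-1 :> R.
Proof. by rewrite /series /= big_nat_recr //= natr1. Qed.

(** This [u] makes $(1+u)/(1-u) = (n+1)/n$, so the artanh bounds apply to the increments of $\ln
    n$. *)
Lemma ln_succ (R : realType) (n : nat) : (0 < n)%N ->
  let u : R := (2 * n%:R + 1)^-1 in
  ln n.+1%:R = ln n%:R + ln ((1 + u) / (1 - u)).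
Proof.
move=> n0 /=; set u := _^-1; have x0 : 0 < n%:R :> R by rewrite ltr0n.
have -> : (1 + u) / (1 - u) = n.+1%:R / n%:R.
  by rewrite -(natr1 n) /u; field; rewrite !gt_eqF //; lra.
by rewrite -lnM ?posrE ?divr_gt0 ?ltr0n// mulrC divfK// gt_eqF.
Qed.

(** Two terms of the artanh series show that the decrease is at least $(2q+1)/(12w^3q^2)$, where $q
    = n(n+1)$ and $w = 2n+1$. *)
Lemma gamma_upperS (R : realType) n : (0 < n)%N ->
  gamma_upper R n.+1 <= gamma_upper R n.
Proof.
move=> n0; rewrite /gamma_upper harmonicS ln_succ//=.
have x0 : 1 <= n%:R :> R by rewrite ler1n.
rewrite -(natr1 n); move: (n%:R) x0 => x x1; set u := (2 * x + 1)^-1.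
have x0 : 0 < x by lra.
have q0 : 0 <= x * (x + 1) by apply: mulr_ge0; lra.
have w0 : 0 <= 2 * x + 1 by lra.
have u0 : 0 < u by rewrite invr_gt0; lra.
have u1 : u < 1 by rewrite invf_lt1; lra.
have := @ln_atanh_ge R u; rewrite (ltW u0) u1 => /(_ isT) h.
have {}h : 2 * (u + u ^+ 3 / 3) <= ln ((1 + u) / (1 - u)).
  apply: le_trans h; rewrite ler_pM2l// lerDl mulr_ge0 ?exprn_ge0// ?invr_ge0//; lra.
suff : 0 <= 2 * (u + u ^+ 3 / 3) - (x + 1)^-1 + 1 / (2 * (x + 1))
     - 1 / (2 * x) - 1 / (12 * (x + 1) ^+ 2) + 1 / (12 * x ^+ 2) by lra.
rewrite (_ : _ + _ =
  (2 * (x * (x + 1)) + 1) / (12 * (2 * x + 1) ^+ 3 * (x * (x + 1)) ^+ 2)); last first.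
  rewrite /u; field; rewrite !gt_eqF //; lra.
move: (x * (x + 1)) (2 * x + 1) q0 w0 => q w q0 w0.
apply: divr_ge0; first lra.
exact: mulr_ge0 (mulr_ge0 (ler0n _ _) (exprn_ge0 _ w0)) (exprn_ge0 _ q0).
Qed.

(** $n \ge 15$ puts $u = 1/(2n+1)$ in the range of [ln_atanh_le]; the resulting rational function
    has positive coefficients in $q = n(n+1)$ and $w = 2n+1$. *)
Lemma gamma_lowerS (R : realType) n : (15 <= n)%N ->
  gamma_lower R n <= gamma_lower R n.+1.
Proof.
move=> n15; rewrite /gamma_lower /gamma_upper harmonicS ln_succ ?(leq_trans _ n15)//=.
have x15 : 15 <= n%:R :> R by rewrite ler_nat.
rewrite -(natr1 n); move: (n%:R) x15 => x x15; set u := (2 * x + 1)^-1.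
have x0 : 0 < x by lra.
have q0 : 0 <= x * (x + 1) by apply: mulr_ge0; lra.
have w0 : 0 <= 2 * x + 1 by lra.
have u0 : 0 < u by rewrite invr_gt0; lra.
have u1 : u <= 31^-1 by rewrite lef_pV2 ?posrE; lra.
have := @ln_atanh_le R u; rewrite (ltW u0) u1 => /(_ isT) h.
suff : 2 * (u + u ^+ 3 / 3 + 961 / 4800 * u ^+ 5) <= (x + 1)^-1 - 1 / (2 * (x + 1))
     + 1 / (2 * x) + 1 / (12 * (x + 1) ^+ 2) - 1 / (12 * x ^+ 2)
     - 1 / (60 * (x + 1) ^+ 4) + 1 / (60 * x ^+ 4) by lra.
rewrite -subr_ge0 (_ : _ - _ = (2559 * (x * (x + 1)) ^+ 4 + 5200 * (x * (x + 1)) ^+ 3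
    + 2680 * (x * (x + 1)) ^+ 2 + 560 * (x * (x + 1)) + 40)
   / (2400 * (2 * x + 1) ^+ 5 * (x * (x + 1)) ^+ 4)); last first.
  by rewrite /u; field; rewrite !gt_eqF //; lra.
move: (x * (x + 1)) (2 * x + 1) q0 w0 => q w q0 w0.
apply: divr_ge0.
  have := exprn_ge0 4 q0; have := exprn_ge0 3 q0; have := exprn_ge0 2 q0; lra.
exact: mulr_ge0 (mulr_ge0 (ler0n _ _) (exprn_ge0 _ w0)) (exprn_ge0 _ q0).
Qed.

(** [gamma_upper] decreases and stays above [gamma_lower R n], so it converges. It differs from $H_k
    - \ln k$ by a null sequence, so the [limn] defining [euler_gamma] is a genuine limit. *)
Lemma euler_gamma_itv (R : realType) n : (15 <= n)%N ->
  gamma_lower R n <= euler_gamma R <= gamma_upper R n.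
Proof.
move=> n15; have n0 : (0 < n)%N by apply: leq_trans n15.
pose v (k : nat) : R := series harmonic k - ln k%:R.
pose w (k : nat) : R := gamma_upper R (k + n).
have wS : nonincreasing_seq w.
  by apply/nonincreasing_seqP => k; apply: gamma_upperS; rewrite addn_gt0 n0 orbT.
have low k : gamma_lower R n <= gamma_lower R (k + n).
  elim: k => [|k IHk]; first by rewrite add0n.
  by apply: le_trans IHk _; apply: gamma_lowerS; apply: leq_trans n15 (leq_addl _ _).
have wlow k : gamma_lower R n <= w k.
  apply: le_trans (low k) _.
  by rewrite /gamma_lower gerBl divr_ge0// mulr_ge0// exprn_ge0.
have cw : cvgn w.
  by apply: nonincreasing_is_cvgn => //; exists (gamma_lower R n) => _ [k _ <-].
(* With $x = k+n$, $e = x^{-1}(1/2 - 1/(12x))$ lies between 0 and $1/(k+1)$. *)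
pose e (k : nat) : R := 1 / (2 * (k + n)%:R) - 1 / (12 * (k + n)%:R ^+ 2).
have ce : e @ \oo --> 0.
  apply: (@squeeze_cvgr _ _ _ _ (cst 0) harmonic);
    [|exact: cvg_cst|exact: cvg_harmonic].
  near=> k; rewrite /e /=.
  have x1 : k%:R + 1 <= (k + n)%:R :> R by rewrite natr1 ler_nat -addn1 leq_add2l.
  rewrite -(natr1 k); move: (k%:R) (ler0n R k) x1 => y y0; move: (_%:R) => x x1.
  have x0 : 0 < x by lra.
  have -> : 1 / (2 * x) - 1 / (12 * x ^+ 2) = x^-1 * (2^-1 - (12 * x)^-1).
    by field; rewrite gt_eqF.
  have xi : (12 * x)^-1 <= 12^-1 by rewrite lef_pV2 ?posrE; lra.
  have xi0 : 0 < (12 * x)^-1 by rewrite invr_gt0; lra.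
  have xv : x^-1 <= (y + 1)^-1 by rewrite lef_pV2 ?posrE; lra.
  have xv0 : 0 < x^-1 by rewrite invr_gt0.
  apply/andP; split; first by apply: mulr_ge0; lra.
  by apply: le_trans xv; rewrite ger_pMr//; lra.
have cv : v @ \oo --> limn w.
  rewrite -(cvg_shiftn n) -[limn w]addr0.
  rewrite (_ : (fun k => v (k + n)%N) = w \+ e); first exact: cvgD.
  by apply/funext => k; rewrite /v /w /e /gamma_upper /=; ring.
have -> : euler_gamma R = limn w by exact: cvg_lim.
apply/andP; split; first by apply: limr_ge => //; near=> k; exact: wlow.
exact: (nonincreasing_cvgn_ge wS cw 0%N).
Unshelve. all: by end_near.
Qed.

(** * Numerical enclosure of $e^\gamma/2$ *)

Lemma harmonic16 (R : realType) :
  series harmonic 16 = 1 + 2^-1 + 3^-1 + 4^-1 + 5^-1 + 6^-1 + 7^-1 + 8^-1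
    + 9^-1 + 10^-1 + 11^-1 + 12^-1 + 13^-1 + 14^-1 + 15^-1 + 16^-1 :> R.
Proof. by rewrite /series /= !big_nat_recr//= big_geq// add0r invr1. Qed.

(** After taking logarithms, $\gamma$ is compared with $\ln(2 \cdot 0.89053\ldots)$. This number is
    near $16/9$, so the quotient is $(1+u)/(1-u)$ with $u$ about $10^{-3}$, where the artanh bounds
    are sharp. *)
Lemma expR_euler_gamma_itv (R : realType) :
  890 / 10 ^+ 3 + 536 / 10 ^+ 6 <= expR (euler_gamma R) / 2
    < 890 / 10 ^+ 3 + 537 / 10 ^+ 6.
Proof.
(* (1+u)/(1-u) is just above 9/8 * 0.890536, (1+u')/(1-u') just below 9/8 * 0.890537. *)
pose u : R := 925 / 10 ^+ 6 + 65 / 10 ^+ 8.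
pose u' : R := 926 / 10 ^+ 6 + 1 / 10 ^+ 7.
have up : 0 < (1 + u) / (1 - u) by apply: divr_gt0; rewrite /u; lra.
have up' : 0 < (1 + u') / (1 - u') by apply: divr_gt0; rewrite /u'; lra.
have lu : ln ((1 + u) / (1 - u)) <= 2 * (u + u ^+ 3 / 3 + 961 / 4800 * u ^+ 5).
  by apply: ln_atanh_le; rewrite /u; lra.
have lu' : 2 * (u' + u' ^+ 3 / 3 + 5^-1 * u' ^+ 5) <= ln ((1 + u') / (1 - u')).
  by apply: ln_atanh_ge; rewrite /u'; lra.
have tu : (890 / 10 ^+ 3 + 536 / 10 ^+ 6) * 2 <= 16 / 9 * ((1 + u) / (1 - u)).
  by rewrite mulrA ler_pdivlMr /u; lra.
have tu' : 16 / 9 * ((1 + u') / (1 - u')) <= (890 / 10 ^+ 3 + 537 / 10 ^+ 6) * 2.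
  by rewrite mulrA ler_pdivrMr /u'; lra.
have p9 : 0 < 16 / 9 :> R by apply: divr_gt0; rewrite ltr0n.
(* Ratios of products of 2, 3 and 5 that equal $(1+u)/(1-u)$ for $u = 1/31$, $1/49$, $1/161$, all
   within the range of [ln_atanh_le]. *)
pose A : R := ln (16 / 15); pose B : R := ln (25 / 24); pose C : R := ln (81 / 80).
have Al : 2 * (31^-1 + 31^-1 ^+ 3 / 3 + 5^-1 * 31^-1 ^+ 5) <= A.
  have := @ln_atanh_ge R 31^-1; rewrite (_ : (_ + _) / _ = 16 / 15); last by field.
  by apply; rewrite invr_ge0 ler0n invf_lt1 ?ltr0n ?ltr1n.
have Au : A <= 2 * (31^-1 + 31^-1 ^+ 3 / 3 + 961 / 4800 * 31^-1 ^+ 5).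
  have := @ln_atanh_le R 31^-1; rewrite (_ : (_ + _) / _ = 16 / 15); last by field.
  by apply; rewrite invr_ge0 ler0n lef_pV2 ?posrE ?ltr0n ?ler_nat.
have Bl : 2 * (49^-1 + 49^-1 ^+ 3 / 3 + 5^-1 * 49^-1 ^+ 5) <= B.
  have := @ln_atanh_ge R 49^-1; rewrite (_ : (_ + _) / _ = 25 / 24); last by field.
  by apply; rewrite invr_ge0 ler0n invf_lt1 ?ltr0n ?ltr1n.
have Bu : B <= 2 * (49^-1 + 49^-1 ^+ 3 / 3 + 961 / 4800 * 49^-1 ^+ 5).
  have := @ln_atanh_le R 49^-1; rewrite (_ : (_ + _) / _ = 25 / 24); last by field.
  by apply; rewrite invr_ge0 ler0n lef_pV2 ?posrE ?ltr0n ?ler_nat.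
have Cl : 2 * (161^-1 + 161^-1 ^+ 3 / 3 + 5^-1 * 161^-1 ^+ 5) <= C.
  have := @ln_atanh_ge R 161^-1; rewrite (_ : (_ + _) / _ = 81 / 80); last by field.
  by apply; rewrite invr_ge0 ler0n invf_lt1 ?ltr0n ?ltr1n.
have Cu : C <= 2 * (161^-1 + 161^-1 ^+ 3 / 3 + 961 / 4800 * 161^-1 ^+ 5).
  have := @ln_atanh_le R 161^-1; rewrite (_ : (_ + _) / _ = 81 / 80); last by field.
  by apply; rewrite invr_ge0 ler0n lef_pV2 ?posrE ?ltr0n ?ler_nat.
have /andP[gl gu] := @euler_gamma_itv R 16 isT.
(* 256/9 = (16/15)^34 * (25/24)^24 * (81/80)^14, so ln 16 + ln (16/9) is a
   combination of [A], [B] and [C]. *)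
have pn k : (k.+1%:R : R) \is Num.pos by rewrite posrE ltr0n.
have lnMn i j k : (i.+1 * j.+1 = k.+1)%N -> ln k.+1%:R = ln i.+1%:R + ln j.+1%:R :> R.
  by move=> <-; rewrite natrM lnM// pn.
(* Arguments are one below the numbers meant: [@lnMn 1 1 3] is $2 \cdot 2 = 4$. *)
have l4 := @lnMn 1 1 3 erefl; have l16 := @lnMn 3 3 15 erefl.
have l15 := @lnMn 2 4 14 erefl; have l8 := @lnMn 1 3 7 erefl.
have l24 := @lnMn 7 2 23 erefl; have l25 := @lnMn 4 4 24 erefl.
have l9 := @lnMn 2 2 8 erefl; have l81 := @lnMn 8 8 80 erefl.
have l80 := @lnMn 15 4 79 erefl.
have AE : A = ln 16 - ln 15 by rewrite /A ln_div// pn.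
have BE : B = ln 25 - ln 24 by rewrite /B ln_div// pn.
have CE : C = ln 81 - ln 80 by rewrite /C ln_div// pn.
move: gl gu; rewrite /gamma_lower /gamma_upper harmonic16 => gl gu.
have lnE (x : R) : 0 < x -> ln (16 / 9 * x) = ln 16 - ln 9 + ln x.
  by move=> x0; rewrite [LHS]lnM ?posrE// (ln_div (pn 15) (pn 8)).
apply/andP; split.
  rewrite ler_pdivlMr//; apply: le_trans tu _.
  rewrite -[leLHS]lnK ?posrE ?(mulr_gt0 p9)// ler_expR lnE//.
  apply: le_trans gl; move: lu; rewrite /u; lra.
rewrite ltr_pdivrMr//; apply: lt_le_trans tu'.
rewrite -[ltRHS]lnK ?posrE ?(mulr_gt0 p9)// ltr_expR lnE//.
apply: le_lt_trans gu _; move: lu'; rewrite /u'; lra.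
Qed.

Theorem theorem4p6 (R : realType) (A : set {poly 'F_2})
    (hmonic : monic_set A) (hprim : primitive_set A) (hA : A <> [set 1]) :
  (erdos_sum R A < (1 + expR (euler_gamma R) / 2)%:E)%E /\
  1 + 890 / 10 ^+ 3 + 536 / 10 ^+ 6 <= 1 + expR (euler_gamma R) / 2
    < 1 + 890 / 10 ^+ 3 + 537 / 10 ^+ 6.
Proof.
have /andP[gl gu] := expR_euler_gamma_itv R; split; last first.
  by rewrite -!addrA lerD2l ltrD2l gl.
(* The sum is at most 1.89, and strictness comes from $e^\gamma/2 \ge 0.890536$. *)
apply: (le_lt_trans (erdos_sum_le R hmonic hprim hA)).
rewrite lte_fin; lra.
Qed.
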